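(* Let $m\in\mathbb N$, $n\in(\mathbb N+1)^m$, and let $M\in\mathbb N_0^n$ be an order $m$ tensor with property (V), with $M_{1_m}=0$, and with set of entries $\{M_k:k\in\mathbb N^m,k\le n\}=\langle\prod_{j=1}^mn_j\rangle$. Then the sets \[A_j=\{M_{1_m+ke_j}:k\in\langle n_j\rangle\}\qquad(j\in\{1,\dots,m\})\] form an $m$-part sum system.
   Context: $\mathbb N=\{1,2,\dots\}$, $\mathbb N_0=\mathbb N\cup\{0\}$, $\mathbb N+1=\{2,3,\dots\}$, $\langle N\rangle=\{0,\dots,N-1\}$. An order $m$ tensor $M\in\mathbb N_0^n$ ($n\in\mathbb N^m$) has entries $M_k\in\mathbb N_0$ for $k\in\mathbb N^m$, $k\le n$ componentwise; $1_m=(1,\dots,1)$, $e_j$ the $j$-th unit vector. Property (V): for all $1\le i<j\le m$ and all index vectors in range, $M_{k_1,\dots,k_i,\dots,k_j,\dots,k_m}+M_{k_1,\dots,k_i',\dots,k_j',\dots,k_m}=M_{k_1,\dots,k_i,\dots,k_j',\dots,k_m}+M_{k_1,\dots,k_i',\dots,k_j,\dots,k_m}$ (vacuous if $m=1$). An $m$-part sum system is a collection of finite sets $A_1,\dots,A_m\subset\mathbb N_0$, each of cardinality at least 2, with $\sum_kA_k=\{x_1+\dots+x_m:x_k\in A_k\}=\langle\prod_k|A_k|\rangle$. *)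

(* Defs.v *)
From mathcomp Require Import all_boot finmap.
From mathcomp Require Import boolp classical_sets cardinality.
Set Implicit Arguments.
Unset Strict Implicit.
Unset Printing Implicit Defensive.
Local Open Scope classical_set_scope.

Section Tensors.
Context {m : nat}.

(* Index vectors have 1-based components; the coordinates themselves are
   numbered by 'I_m. *)
Definition index_vector := {ffun 'I_m -> nat}.

(* A tensor of format n is given by its entries at the index vectors within
   range of n; the values of the function elsewhere are irrelevant, and every
   notion below only looks at indices within range. *)
Definition tensor := index_vector -> nat.

Implicit Types (n k : index_vector) (M : tensor).

Definition in_range n : set index_vector :=
  [set k | forall j, 1 <= k j <= n j].

Definition ones : index_vector := [ffun=> 1].

Definition unit_vector (j : 'I_m) : index_vector := [ffun i => (i == j : nat)].

Definition axis_index (j : 'I_m) (a : nat) : index_vector :=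
  [ffun i => ones i + a * unit_vector j i].

Definition subst_index k (i : 'I_m) (a : nat) : index_vector :=
  [ffun l => if l == i then a else k l].

Definition property_V n M : Prop :=
  forall (i j : 'I_m) k (a b : nat), i < j ->
    in_range n k -> 1 <= a <= n i -> 1 <= b <= n j ->
    M k + M (subst_index (subst_index k i a) j b) =
    M (subst_index k j b) + M (subst_index k i a).

Definition entries n M : set nat := [set M k | k in in_range n].

Definition axis_entries n M (j : 'I_m) : set nat :=
  [set M (axis_index j a) | a in `I_(n j)].

Definition sumset (A : 'I_m -> set nat) : set nat :=
  [set \sum_(j < m) x j | x in [set x : {ffun 'I_m -> nat} | forall j, A j (x j)]].

(* fset_set is only meaningful on finite sets, whence the first clause. *)
Definition sum_system (A : 'I_m -> set nat) : Prop :=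
  [/\ forall j, finite_set (A j),
      forall j, 2 <= #|` fset_set (A j)| &
      sumset A = `I_(\prod_(j < m) #|` fset_set (A j)|)].

End Tensors.

Arguments index_vector : clear implicits.
Arguments tensor : clear implicits.
Arguments ones : clear implicits.

(* Main.v *)
(** By (V), changing one coordinate changes [M] by an amount that does not
    depend on the other coordinates; since [M] vanishes at [ones], an entry of
    [M] is therefore the sum of the axis entries below its coordinates. So the
    sumset of the axis sets is the set of all entries. The latter has as many
    elements as there are index vectors, so [M] is injective on index vectors,
    whence the [j]-th axis set has exactly [n j] elements. *)
Require Import Defs.
From mathcomp Require Import all_boot finmap.
From mathcomp Require Import boolp classical_sets cardinality.
From mathcomp Require Import zify.
Local Open Scope classical_set_scope.

(** These vectors lead from [ones m] to [k] by filling in one coordinate at a time, so that [M k]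
    can be computed by telescoping. *)
Definition truncate_index {m : nat} (t : nat) (k : index_vector m) :
  index_vector m := [ffun l : 'I_m => if l < t then k l else 1].

Section Decomposition.
Context {m : nat} {n : index_vector m}.
Implicit Types (k : index_vector m) (t : nat).

Lemma truncate_index0 k : truncate_index 0 k = ones m.
Proof. by apply/ffunP => l; rewrite !ffunE. Qed.

Lemma truncate_index_full k : truncate_index m k = k.
Proof. by apply/ffunP => l; rewrite !ffunE ltn_ord. Qed.

Lemma truncate_indexS (i : 'I_m) k :
  truncate_index i.+1 k = subst_index (truncate_index i k) i (k i).
Proof.
apply/ffunP => l; rewrite !ffunE ltnS leq_eqVlt -(inj_eq val_inj) /=.
by have [/val_inj -> //|] := eqVneq (l : nat) i.
Qed.

Lemma axis_indexE (j : 'I_m) a :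
  axis_index j a = subst_index (ones m) j a.+1.
Proof.
by apply/ffunP => l; rewrite !ffunE; case: eqP => _; rewrite ?muln1 ?muln0.
Qed.

Lemma truncate_in_range t k : in_range n k -> in_range n (truncate_index t k).
Proof.
move=> kn j; rewrite ffunE; have := kn j.
by case: (j < t) => //; lia.
Qed.

(** Induction on [t]: (V) for coordinates [t] and [s] shows that filling in coordinate [t] does not
    alter the change caused by moving coordinate [s] from 1 to [k s]. The equality of differences is
    stated with sums, since subtraction on [nat] truncates. *)
Lemma truncate_axis_index (M : tensor m) (s : 'I_m) k t :
  property_V n M -> in_range n k -> t <= s ->
  M (subst_index (truncate_index t k) s (k s)) + M (ones m) =
  M (truncate_index t k) + M (axis_index s (k s).-1).
Proof.
move=> hV kn; have ks0 := kn s.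
rewrite axis_indexE prednK; last by case/andP: ks0.
elim: t => [|t IH] ts; first by rewrite truncate_index0 addnC.
have tm : t < m by exact: ltn_trans ts (ltn_ord s).
have := hV (Ordinal tm) s _ _ _ ts (truncate_in_range t k kn) (kn _) ks0.
have := IH (ltnW ts).
rewrite -(truncate_indexS (Ordinal tm)) /=; lia.
Qed.

Lemma tensor_axis_sum (M : tensor m) k :
  property_V n M -> M (ones m) = 0 -> in_range n k ->
  M k = \sum_(j < m) M (axis_index j (k j).-1).
Proof.
move=> hV h0 kn.
suff partial_sum t : t <= m ->
    M (truncate_index t k) = \sum_(j < m | j < t) M (axis_index j (k j).-1).
  rewrite -[in LHS](truncate_index_full k) partial_sum //.
  by apply: eq_bigl => j; rewrite ltn_ord.
elim: t => [|t IH] tm; first by rewrite truncate_index0 h0 big_pred0.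
pose s := Ordinal tm; rewrite (bigD1 s) //=.
(* Since [M] vanishes at [ones m], filling in coordinate [s] adds exactly its axis entry. *)
have := truncate_axis_index M s k t hV kn (leqnn _).
rewrite h0 addn0 -(truncate_indexS s) /= => ->.
rewrite IH ?(ltnW tm) // addnC; congr (_ + _); apply: eq_bigl => j.
by rewrite -(inj_eq val_inj) /= ltnS andbC -ltn_neqAle.
Qed.

(** Pigeonhole: there are as many index vectors in range as values to be attained. *)
Lemma entries_inj (M : tensor m) :
  entries n M = `I_(\prod_(j < m) n j) ->
  forall k l, in_range n k -> in_range n l -> M k = M l -> k = l.
Proof.
move=> hM.
(* [N] bounds every coordinate, so the index vectors in range can be counted as the members of [box]
   inside a finite type; [box] excludes the coordinate 0. *)
pose N := \max_(j < m) n j.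
pose box := family (fun j => [pred a : 'I_N.+1 | 0 < a <= n j]).
pose vec (a : {ffun 'I_m -> 'I_N.+1}) : index_vector m := [ffun j => a j : nat].
pose code k : {ffun 'I_m -> 'I_N.+1} := [ffun j => inord (k j)].
have nN j : n j <= N by exact: leq_bigmax.
have codeK k : in_range n k -> vec (code k) = k.
  move=> kn; apply/ffunP => j; rewrite !ffunE inordK // ltnS.
  by apply: leq_trans (nN j); case/andP: (kn j).
have code_box k : in_range n k -> code k \in box.
  move=> kn; apply/familyP => j; rewrite inE.
  by have := congr1 (fun f : index_vector m => f j) (codeK k kn); rewrite ffunE => ->.
have card_box : #|box| = \prod_(j < m) n j.
  rewrite card_family foldrE big_image /=; apply: eq_bigr => j _.
  rewrite -sum1_card -(big_mkord (fun a => 0 < a <= n j) (fun=> 1)) sum1_count.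
  rewrite /index_iota subn0 -size_filter.
  have -> : [seq a <- iota 0 N.+1 | 0 < a <= n j] = iota 1 (n j).
    apply: (@irr_sorted_eq _ ltn ltn_trans ltnn).
    - exact: sorted_filter ltn_trans _ _ (iota_ltn_sorted _ _).
    - exact: iota_ltn_sorted.
    by move=> a; rewrite mem_filter !mem_iota; have := nN j; lia.
  by rewrite size_iota.
have inj_box : {in box &, injective (M \o vec)}.
  (* The list of values of [M] on [box] contains every number below the product and is no longer
     than that product, so it has no repetition. *)
  apply/dinjectiveP; apply: leq_size_uniq (iota_uniq 0 (\prod_(j < m) n j)) _ _.
    move=> x; rewrite mem_iota add0n => /andP[_ xP].
    have [k kn <-] : entries n M x by rewrite hM.
    by apply/mapP; exists (code k); rewrite ?mem_enum ?code_box //= codeK.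
  by rewrite size_map size_iota -cardE card_box.
move=> k l kn ln Mkl; rewrite -(codeK k kn) -(codeK l ln); congr vec.
by apply: inj_box; rewrite ?code_box //= !codeK.
Qed.

Lemma sumset_axis_entries (M : tensor m) :
  property_V n M -> M (ones m) = 0 ->
  sumset (axis_entries n M) = entries n M.
Proof.
move=> hV h0; apply/seteqP; split=> [_ [x Ax <-]|_ [k kn <-]].
  have /choice[a aP] j : exists a, a < n j /\ M (axis_index j a) = x j.
    by have [a an ax] := Ax j; exists a.
  (* Axis offsets start at 0 and coordinates at 1, hence the successor here and the predecessor in
     the converse inclusion. *)
  have kn : in_range n [ffun j => (a j).+1].
    by move=> j; rewrite ffunE; case: (aP j).
  exists [ffun j => (a j).+1] => //.
  rewrite (tensor_axis_sum M _ hV h0 kn); apply: eq_bigr => j _.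
  by rewrite ffunE; case: (aP j).
exists [ffun j => M (axis_index j (k j).-1)].
  by move=> j; rewrite ffunE; exists (k j).-1 => //=; have := kn j; lia.
by rewrite (tensor_axis_sum M k hV h0 kn); apply: eq_bigr => j _; rewrite ffunE.
Qed.

(** Distinct offsets give axis indices that differ at coordinate [j], so [entries_inj] separates
    their entries. Positivity of [n] keeps the other coordinates, all 1, in range. *)
Lemma card_axis_entries (M : tensor m) (j : 'I_m) :
  (forall i, 0 < n i) -> entries n M = `I_(\prod_(j < m) n j) ->
  #|` fset_set (axis_entries n M j)| = n j.
Proof.
move=> n0 hM; apply: card_fset_set; apply: inj_card_eq => a b.
have in_axis c : c < n j -> in_range n (axis_index j c).
  move=> cn i; rewrite axis_indexE !ffunE; case: eqP => [->|_]; first by lia.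
  exact: n0.
rewrite !inE => an bn /(entries_inj M hM _ _ (in_axis _ an) (in_axis _ bn)).
by move/ffunP/(_ j); rewrite !axis_indexE !ffunE eqxx => -[].
Qed.

End Decomposition.

Theorem theorem4 (m : nat) (n : index_vector m) (M : tensor m)
  (hm : 0 < m)
  (hn : forall j : 'I_m, 2 <= n j)
  (hV : property_V n M)
  (h0 : M (ones m) = 0)
  (hM : entries n M = `I_(\prod_(j < m) n j)) :
  sum_system (axis_entries n M).
Proof.
have cardA j : #|` fset_set (axis_entries n M j)| = n j.
  by apply: card_axis_entries hM => i; exact: ltnW (hn i).
split=> [j|j|]; first exact/finite_image/finite_II.
  by rewrite cardA.
rewrite (sumset_axis_entries M hV h0) hM.
by rewrite (eq_bigr _ (fun j _ => cardA j)).
Qed.
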